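(* Let $n\ge2$ and let $\lambda,\mu$ be integer partitions of $n$ with $\lambda\unlhd\mu$. If a subgroup $G\le S_n$ is $\lambda$-transitive, then $G$ is $\mu$-transitive.
   Context: $\Omega=\{1,\dots,n\}$ and $S_n=\mathrm{Sym}(\Omega)$. An integer partition of $n$ is a weakly decreasing sequence of positive integers with sum $n$. An ordered set partition of $\Omega$ is a tuple $P=(P_1,\dots,P_k)$ of pairwise disjoint non-empty subsets with union $\Omega$, with $|P_1|\ge\dots\ge|P_k|$; its shape is $(|P_1|,\dots,|P_k|)$. A subgroup $G\le S_n$ is $\lambda$-transitive if for any two ordered set partitions $P,Q$ of shape $\lambda$ there is $g\in G$ with $gP_i=Q_i$ (as sets) for every $i$. Dominance order: $\lambda\unlhd\mu$ iff $\sum_{i=1}^j\lambda_i\le\sum_{i=1}^j\mu_i$ for all $j$ (missing parts are $0$). *)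

(* Defs.v *)
From mathcomp Require Import all_boot all_fingroup.

Set Implicit Arguments.
Unset Strict Implicit.
Unset Printing Implicit Defensive.

(* The set Omega = {1, .., n} is represented by 'I_n = {0, .., n - 1}. *)

Definition int_partition (n : nat) (l : seq nat) : bool :=
  [&& sorted geq l, all (fun k => 0 < k) l & sumn l == n].

(* Parts are indexed from 0; nth 0 returns 0 beyond the last part. *)
Definition dominated (l m : seq nat) : Prop :=
  forall j : nat, \sum_(i < j) nth 0 l i <= \sum_(i < j) nth 0 m i.

Definition set_partition_shape (n : nat) (P : seq {set 'I_n}) : seq nat :=
  [seq #|A| | A : {set 'I_n} <- P].

Definition ordered_set_partition (n : nat) (P : seq {set 'I_n}) : bool :=
  [&& pairwise (fun A B : {set 'I_n} => [disjoint A & B]) P,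
      set0 \notin P,
      \bigcup_(A <- P) A == [set: 'I_n]
    & sorted geq (set_partition_shape P)].

Definition shape_transitive (n : nat) (l : seq nat) (G : {group 'S_n}) : Prop :=
  forall P Q : seq {set 'I_n},
    ordered_set_partition P -> set_partition_shape P = l ->
    ordered_set_partition Q -> set_partition_shape Q = l ->
    exists2 g : 'S_n, g \in G & [seq g @: A | A : {set 'I_n} <- P] = Q.

(* Main.v *)
Require Import Defs.
From mathcomp Require Import all_boot all_order all_fingroup all_algebra.
From mathcomp Require Import zify.

Set Implicit Arguments.
Unset Strict Implicit.
Unset Printing Implicit Defensive.

Import Order.TTheory GRing.Theory Num.Theory.

(** An ordered set partition with at most k blocks is a colouring, or word,
    w : X -> C of the points, whose content lists the sizes of the blocks, and
    G is transitive on a shape iff it is transitive on the words of the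
    corresponding content.  Blocks may then be empty and sizes need not be
    sorted, which leaves room to change the shape one point at a time.

    Dominance is generated by moves of one box from a part b to a part a
    smaller than b, so it suffices to treat one such move: if G is transitive
    after the move, it is transitive before it
    ([content_transitive_box]).  This follows from linear algebra.  Let E be
    the operator [shift a b], which sends a function f on words to
    (E f)(w) = the sum of f over the words obtained from w by repainting one
    point from a to b, and F the opposite operator [shift b a].  These two are
    adjoint to each other for the scalar product on functions, and they satisfy
    the sl_2 relation: their commutator multiplies f(w) by the number of points
    of colour b minus the number of points of colour a in w.  Hence
      |E f|^2 = |F f|^2 + sum over w of (#b(w) - #a(w)) f(w)^2
    ([shift_norm]), so that E is injective on functions supported on words with
    more b than a ([shift_inj]).  Since E commutes with G, it maps the indicator
    of a G-orbit before the move to a G-invariant function, hence to a constant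
    function, on the words after the move.  It also maps constants to constants,
    so by injectivity the indicator of the orbit is constant: there is only one
    orbit.

    It remains to join two partitions c, d with c dominated by d by moves
    ([content_transitive_dominated]).  If c and d differ, let i be the first
    index where d i < c i, and j < i an index where c j < d j.  As c is sorted,
    d i < c i <= c j < d j, and moving a box of d from j to i preserves
    dominance because d is at least c everywhere before i. *)

(** * Words and the shift operators *)

Definition recolour (X C : finType) (w : {ffun X -> C}) (x : X) (a : C) :
    {ffun X -> C} :=
  [ffun y => if y == x then a else w y].

Definition content (X C : finType) (w : {ffun X -> C}) (a : C) : nat :=
  #|[set x | w x == a]|.

(** The raising operator of sl_2 acting on the span of the words.  It sends
    functions on words of content c to functions on words of content
    [move_box c a b]. *)
Definition shift (R : nmodType) (X C : finType) (a b : C)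
    (f : {ffun X -> C} -> R) (w : {ffun X -> C}) : R :=
  (\sum_(x | w x == a) f (recolour w x b))%R.

Lemma recolourK (X C : finType) (w : {ffun X -> C}) x a :
  recolour (recolour w x a) x (w x) = w.
Proof. by apply/ffunP => y; rewrite !ffunE; case: eqP => [->|]. Qed.

(** Repainting x identifies the pairs (w, x) with w x = a and the pairs (u, x)
    with u x = b, and each u occurs in [content u b] of the latter. *)
Lemma shift_diagonal (R : nmodType) (X C : finType) (a b : C)
    (f : {ffun X -> C} -> R) :
  (\sum_(w : {ffun X -> C}) \sum_(x | w x == a) f (recolour w x b)
    = \sum_(w : {ffun X -> C}) f w *+ content w b)%R.
Proof.
under [RHS]eq_bigr => w _.
  rewrite /content -sumr_const.
  under eq_bigl => x do rewrite inE.
  over.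
rewrite (exchange_big_dep xpredT) //= [RHS](exchange_big_dep xpredT) //=.
apply: eq_bigr => x _.
rewrite (reindex_onto (fun w => recolour w x a) (fun w => recolour w x b)) /=.
  apply: eq_big => [w|w /andP[_ /eqP->] //].
  rewrite ffunE !eqxx /=; apply/eqP/eqP => [<-|<-]; first by rewrite !ffunE eqxx.
  exact: recolourK.
by move=> w /eqP <-; rewrite recolourK.
Qed.

(** The terms of the squared norm of [shift a b f] that come from two distinct
    repainted points. *)
Definition shift_cross (R : pzRingType) (X C : finType) (a b : C)
    (f : {ffun X -> C} -> R) : R :=
  (\sum_x \sum_(y | y != x) \sum_(w : {ffun X -> C} | (w x == a) && (w y == a))
     f (recolour w x b) * f (recolour w y b))%R.

Lemma shift_sqr (R : comPzRingType) (X C : finType) (a b : C)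
    (f : {ffun X -> C} -> R) :
  (\sum_w shift a b f w ^+ 2
    = \sum_w (f w ^+ 2) *+ content w b + shift_cross a b f)%R.
Proof.
rewrite -(shift_diagonal a) /shift_cross.
under eq_bigr => w _.
  rewrite expr2 /shift big_distrlr /=.
  under eq_bigr => x wx do rewrite (bigD1 x wx) /= -expr2.
  rewrite big_split /=.
  over.
rewrite big_split /=; congr (_ + _)%R.
rewrite (exchange_big_dep xpredT) //=; apply: eq_bigr => x _.
rewrite (exchange_big_dep (fun y => y != x)) /=; last by move=> w y _ /andP[].
apply: eq_bigr => y yx; apply: eq_bigl => w.
by rewrite yx andbT.
Qed.

(** If w has colour a at x and y, let u be w with both points repainted to b.
    Repainting x in w gives the same word as repainting y back to a in u, so
    the products summed on the two sides are the same up to the order of their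
    factors. *)
Lemma shift_cross_sym (R : comPzRingType) (X C : finType) (a b : C)
    (f : {ffun X -> C} -> R) :
  shift_cross a b f = shift_cross b a f.
Proof.
apply: eq_bigr => x _; apply: eq_bigr => y /negbTE yx.
have xy : (x == y) = false by rewrite eq_sym.
pose both (c : C) (w : {ffun X -> C}) := recolour (recolour w x c) y c.
have bothK c d (w : {ffun X -> C}) : w x = d -> w y = d -> both d (both c w) = w.
  move=> wx wy; apply/ffunP => z; rewrite !ffunE.
  by case: (eqVneq z y) => [->//|_]; case: (eqVneq z x) => [->//|_].
rewrite (reindex_onto (both a) (both b)) /=; last first.
  by move=> w /andP[/eqP wx /eqP wy]; apply: bothK.
have cond w : (both a w x == a) && (both a w y == a) &&
    (both b (both a w) == w) = (w x == b) && (w y == b).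
  rewrite {1 2}/both !ffunE !eqxx xy eqxx /=.
  apply/eqP/andP => [<-|[/eqP wx /eqP wy]].
    by rewrite /both !ffunE !eqxx xy eqxx.
  exact: bothK.
apply: eq_big => // w; rewrite cond => /andP[/eqP wx /eqP wy].
rewrite mulrC; congr (f _ * f _)%R; apply/ffunP => z; rewrite !ffunE.
  by have [->|//] := eqVneq z y; rewrite yx wy.
by have [->|//] := eqVneq z x; rewrite xy wx.
Qed.

(** The commutation relation of sl_2 in the form of a quadratic identity: the
    cross terms of both norms cancel and the diagonal terms count colours.  It
    is written with sums on both sides so as to hold in any commutative ring. *)
Lemma shift_norm (R : comPzRingType) (X C : finType) (a b : C)
    (f : {ffun X -> C} -> R) :
  (\sum_w shift a b f w ^+ 2 + \sum_w (f w ^+ 2) *+ content w a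
    = \sum_w shift b a f w ^+ 2 + \sum_w (f w ^+ 2) *+ content w b)%R.
Proof.
rewrite !shift_sqr shift_cross_sym addrAC [RHS]addrAC.
by congr (_ + _)%R; apply: addrC.
Qed.

(** If [shift a b f] vanishes, [shift_norm] bounds the sum of the
    f(w)^2 #b(w) by the sum of the f(w)^2 #a(w), whereas the support of f makes
    it larger term by term. *)
Lemma shift_inj (R : realDomainType) (X C : finType) (a b : C)
    (f : {ffun X -> C} -> R) :
  (forall w, f w != 0%R -> content w a < content w b) ->
  (forall w, shift a b f w = 0%R) ->
  forall w, f w = 0%R.
Proof.
move=> supp ker w0; apply/eqP; rewrite -[_ == _]negbK; apply/negP => fw0.
have /eqP := shift_norm a b f.
rewrite big1 ?add0r => [|w _]; last by rewrite ker expr0n.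
apply/negP; rewrite lt_eqF //.
apply: ltr_wpDl; first by apply: sumr_ge0 => w _; apply: sqr_ge0.
rewrite (bigD1 w0) //= [ltRHS](bigD1 w0) //=; apply: ltr_leD.
  by rewrite ltr_pMn2l ?supp // exprn_even_gt0.
apply: ler_sum => w _; have [->|fw] := eqVneq (f w) 0%R.
  by rewrite expr0n !mul0rn.
by apply: ler_wpMn2l; [apply: sqr_ge0 | apply/ltnW/supp].
Qed.

(** * Moving one box *)

Definition content_transitive (X C : finType) (c : C -> nat)
    (G : {group {perm X}}) : Prop :=
  forall w w' : {ffun X -> C}, content w =1 c -> content w' =1 c ->
  exists2 g : {perm X}, g \in G & forall x, w' (g x) = w x.

(** One box goes from [b] to [a]; the truncated predecessor gives a genuine move
    only when [c b] is positive. *)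
Definition move_box (C : finType) (c : C -> nat) (a b : C) : C -> nat :=
  fun d => if d == a then (c d).+1 else if d == b then (c d).-1 else c d.

Lemma content_recolour (X C : finType) (a b : C) (w : {ffun X -> C}) x :
  a != b -> w x = b ->
  content (recolour w x a) =1 move_box (content w) a b.
Proof.
move=> ab wx d; rewrite /move_box /content.
have [->{d}|da] := eqVneq d a.
  rewrite (_ : [set _ | _] = x |: [set y | w y == a]).
    by rewrite cardsU1 inE wx eq_sym (negbTE ab).
  by apply/setP => y; rewrite !inE ffunE; case: (y == x); rewrite ?eqxx.
have [->{d da}|db] := eqVneq d b.
  rewrite [in RHS](cardsD1 x) inE wx eqxx add1n /=; apply: eq_card => y.
  by rewrite !inE ffunE; case: (y == x); rewrite //= (negbTE ab).
apply: eq_card => y; rewrite !inE ffunE; have [->|//] := eqVneq y x.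
by rewrite wx eq_sym (negbTE da) eq_sym (negbTE db).
Qed.

Lemma move_boxK (C : finType) (c c' : C -> nat) (a b : C) :
  a != b -> 0 < c b -> c' =1 move_box c a b -> c =1 move_box c' b a.
Proof.
move=> ab cb cc' d; rewrite /move_box cc' /move_box.
have [->|_] := eqVneq d b; last by case: (eqVneq d a).
by rewrite eq_sym (negbTE ab) prednK.
Qed.

Lemma eq_move_box (C : finType) (c c' : C -> nat) (a b : C) :
  c =1 c' -> move_box c a b =1 move_box c' a b.
Proof. by move=> cc' d; rewrite /move_box cc'. Qed.

(** Each word of content [move_box c a b] has (c a).+1 points of colour a, so
    [shift a b] multiplies constants by (c a).+1.  Hence it kills
    (c a).+1 f - K, cut off outside the words of content c, and [shift_inj]
    shows that f is K / (c a).+1 on these. *)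
Lemma shift_const_inj (R : realDomainType) (X C : finType) (c : C -> nat)
    (a b : C) (f : {ffun X -> C} -> R) (K : R) :
  c a < c b ->
  (forall w, content w =1 move_box c a b -> shift a b f w = K) ->
  forall w w', content w =1 c -> content w' =1 c -> f w = f w'.
Proof.
move=> cab fK.
have ab : a != b by apply: contraTneq cab => ->; rewrite ltnn.
have ba : b != a by rewrite eq_sym.
have cb : 0 < c b by apply: leq_ltn_trans cab.
pose has_content (c0 : C -> nat) (w : {ffun X -> C}) :=
  [forall d, content w d == c0 d].
have has_contentP c0 w : reflect (content w =1 c0) (has_content c0 w).
  by apply: (iffP forallP) => H d; apply/eqP.
pose psi w : R := (if has_content c w then f w *+ (c a).+1 - K else 0)%R.
suff psi0 w : psi w = 0%R.
  suff fE w : content w =1 c -> (f w *+ (c a).+1 = K)%R.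
    move=> w w' /fE fw /fE fw'.
    by apply: (pmulrnI (ltn0Sn (c a))); rewrite fw fw'.
  by move/has_contentP => wc; apply/eqP; rewrite -subr_eq0 -(psi0 w) /psi wc.
apply: (shift_inj (a := a) (b := b)) => {}w.
  by rewrite /psi; case: has_contentP => [wc _|]; rewrite ?eqxx // !wc.
(* Whether psi is cut off at a repainting of w depends on w alone, so the sum *)
(* in the shift of psi is either complete or empty.                           *)
have has_content_rec x : w x = a ->
    has_content c (recolour w x b) = has_content (move_box c a b) w.
  move=> wx; have wa : 0 < content w a.
    by apply/card_gt0P; exists x; rewrite inE wx.
  have E := content_recolour ba wx.
  apply/has_contentP/has_contentP => [rc d|wc d].
    by rewrite (move_boxK ba wa E) (eq_move_box a b rc).
  by rewrite E (eq_move_box b a wc) -(move_boxK ab cb (fun=> erefl)).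
have psi_rec x : w x == a -> psi (recolour w x b) =
    (if has_content (move_box c a b) w then f (recolour w x b) *+ (c a).+1 - K
     else 0)%R.
  by move=> /eqP wx; rewrite /psi has_content_rec.
rewrite /shift (eq_bigr _ psi_rec); case: has_contentP => [wc|_]; last first.
  by rewrite big1.
have wa : #|[pred x | w x == a]| = (c a).+1.
  by have := wc a; rewrite /content cardsE /move_box eqxx.
by rewrite sumrB sumrMnl -/(shift a b f w) fK // sumr_const wa subrr.
Qed.

(** The indicator of the orbit of w0 is G-invariant, hence so is its image under
    [shift a b], which is therefore constant on the words of content
    [move_box c a b].  By [shift_const_inj] the indicator takes the same value
    at w1 as at w0. *)
Lemma content_transitive_box (X C : finType) (c : C -> nat) (a b : C)
    (G : {group {perm X}}) :
  c a < c b ->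
  content_transitive (move_box c a b) G -> content_transitive c G.
Proof.
move=> cab Gtr w0 w1 w0c w1c.
have ab : a != b by apply: contraTneq cab => ->; rewrite ltnn.
have cb : 0 < c b by apply: leq_ltn_trans cab.
pose pull (w : {ffun X -> C}) (g : {perm X}) : {ffun X -> C} :=
  [ffun x => w (g x)].
pose orb w : int := ([exists g in G, pull w g == w0] : nat)%:R%R.
have orb_pull w h : h \in G -> orb (pull w h) = orb w.
  move=> hG; congr (nat_of_bool _)%:R%R.
  apply/exists_inP/exists_inP => [[g gG /eqP gw]|[g gG /eqP gw]].
    exists (g * h)%g; first exact: groupM.
    by apply/eqP; rewrite -gw; apply/ffunP => x; rewrite !ffunE permM.
  exists (g * h^-1)%g; first by rewrite groupM ?groupV.
  by apply/eqP; rewrite -gw; apply/ffunP => x; rewrite !ffunE permM permKV.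
have shift_pull w h : h \in G -> shift a b orb (pull w h) = shift a b orb w.
  move=> hG; rewrite [RHS](reindex_inj (@perm_inj _ h)) /shift.
  apply: eq_big => [x|x _]; first by rewrite ffunE.
  rewrite -[RHS](orb_pull _ h) //; congr orb; apply/ffunP => y.
  by rewrite !ffunE (inj_eq perm_inj).
(* Any word of the moved content serves to name the constant value. *)
have [x w0x] : exists x, w0 x = b.
  have : 0 < content w0 b by rewrite w0c.
  by case/card_gt0P => x; rewrite inE => /eqP; exists x.
pose w2 := recolour w0 x a.
have w2c : content w2 =1 move_box c a b.
  by move=> d; rewrite (content_recolour ab w0x) (eq_move_box a b w0c).
have shift_orb w : content w =1 move_box c a b ->
    shift a b orb w = shift a b orb w2.
  move=> wc; have [g gG gw] := Gtr _ _ wc w2c.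
  by rewrite -(shift_pull w2 g) //; congr shift; apply/ffunP => y; rewrite ffunE.
have := shift_const_inj cab shift_orb w1c w0c.
rewrite /orb [X in _ = (nat_of_bool X)%:R%R](_ : _ = true); last first.
  apply/exists_inP; exists 1%g => //.
  by apply/eqP/ffunP => y; rewrite ffunE perm1.
case: exists_inP => // -[g gG /eqP gw] _.
by exists g => // y; rewrite -gw ffunE.
Qed.

(** * Dominance as a chain of box moves *)

(** Membership of the two parts in P is added as a number on the opposite sides,
    which covers all positions of a box move relative to P at once. *)
Lemma sum_move_box (C : finType) (c : C -> nat) (a b : C) (P : pred C) :
  a != b -> 0 < c b ->
  \sum_(d | P d) move_box c a b d + P b = \sum_(d | P d) c d + P a.
Proof.
move=> ab cb.
have sum_eq e : \sum_(d | P d) (d == e : nat) = P e.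
  rewrite big_mkcond (bigD1 e) //= eqxx big1 ?addn0 => [|d /negbTE ->].
    by case: (P e).
  by case: (P d).
rewrite -(sum_eq b) -(sum_eq a) -!big_split; apply: eq_bigr => d _.
rewrite /move_box /=; have [->|_] := eqVneq d a.
  by rewrite (negbTE ab) addn0 addn1.
by have [->|_] := eqVneq d b; rewrite addn0 // addn1 prednK.
Qed.

Lemma ltn_sum (I : finType) (P : pred I) (F H : I -> nat) (i : I) :
  P i -> F i < H i -> (forall j, P j -> F j <= H j) ->
  \sum_(j | P j) F j < \sum_(j | P j) H j.
Proof.
move=> Pi FHi FH; rewrite (bigD1 i) // [ltnRHS](bigD1 i) //= -addSn.
by apply: leq_add => //; apply: leq_sum => j /andP[/FH].
Qed.

(** By induction on the total excess of d over c, for d not necessarily sorted: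
    each move lowers the excess by one and keeps dominance, but may break the
    order of d. *)
Lemma content_transitive_dominated (X : finType) (k : nat) (c d : 'I_k -> nat)
    (G : {group {perm X}}) :
  (forall i j : 'I_k, i <= j -> c j <= c i) ->
  (forall s, \sum_(i < k | i < s) c i <= \sum_(i < k | i < s) d i) ->
  \sum_(i < k) c i = \sum_(i < k) d i ->
  content_transitive c G -> content_transitive d G.
Proof.
move=> c_dec; have [N] := ubnP (\sum_(i < k) (d i - c i)).
elim: N d => // N IHN d dN dom tot Gtr.
have [/existsP[i0 i0P]|] := boolP [exists i : 'I_k, d i < c i]; last first.
  rewrite negb_exists => /forallP ge.
  have eq_cd i : c i = d i.
    apply/eqP; rewrite eqn_leq [d i <= _]leqNgt leqNgt ge /=; apply: contraT.
    have ge' t : c t <= d t by rewrite leqNgt ge.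
    rewrite negbK => lt_i.
    have := ltn_sum (P := predT) isT lt_i (fun t _ => ge' t).
    by rewrite tot ltnn.
  by move=> w w' wd w'd; apply: Gtr => i; rewrite ?wd ?w'd eq_cd.
have [i lt_di i_min] :=
  @arg_minnP _ i0 (fun i => d i < c i) (fun i : 'I_k => i : nat) i0P.
have ge_before (t : 'I_k) : t < i -> c t <= d t.
  by move=> ti; rewrite leqNgt; apply: contraL ti => /i_min; rewrite leqNgt.
(* Without such a j, the partial sum of d up to i would be below that of c. *)
have [j ji gt_dj] : exists2 j : 'I_k, j < i & c j < d j.
  have [/exists_inP//|] := boolP [exists (j : 'I_k | j < i), c j < d j].
  rewrite negb_exists_in => /forall_inP le_before.
  have le_before' (t : 'I_k) : t < i.+1 -> d t <= c t.
    rewrite ltnS leq_eqVlt => /predU1P[/val_inj -> | ti]; first exact: ltnW.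
    by rewrite leqNgt le_before.
  have := ltn_sum (P := fun t : 'I_k => t < i.+1) (ltnSn i) lt_di le_before'.
  by rewrite ltnNge dom.
have dji : d i < d j by have := c_dec _ _ (ltnW ji); lia.
have dj : 0 < d j by lia.
have ij : i != j by apply: contraTneq ji => ->; rewrite ltnn.
apply: (content_transitive_box dji); apply: IHN => // [|s|].
- rewrite ltnS in dN; apply: leq_trans dN.
  apply: (ltn_sum (i := j)) => // [|t _]; rewrite /move_box.
    by rewrite eq_sym (negbTE ij) eqxx; lia.
  by have [->|_] := eqVneq t i; [lia | case: eqVneq => [->|//]; lia].
- have box : \sum_(t < k | t < s) move_box d i j t + (j < s) =
             \sum_(t < k | t < s) d t + (i < s).
    exact: (sum_move_box (fun t : 'I_k => t < s) ij dj).
  move: box (dom s); case: (ltnP i s) => [i_s|si] /=.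
    by rewrite (ltn_trans ji i_s); lia.
  case: (ltnP j s) => js /=; last by lia.
  (* Here j < s <= i: the partial sum of d drops by one, but it exceeded that *)
  (* of c, as c <= d before i and c j < d j.                                  *)
  rewrite addn0 addn1 -[_ <= \sum_(_ < _ | _) move_box _ _ _ _]ltnS => -> _.
  by apply: (ltn_sum (i := j)) => // t ts; apply/ge_before/(leq_trans ts).
apply: (@addIn 1); rewrite tot; exact/esym/(sum_move_box predT ij dj).
Qed.

(** * Words and ordered set partitions *)

(** The blocks of a word are its colour classes.  Only the first [size l]
    colours are kept, since blocks have to be nonempty; the other colours do
    not occur in a word of this content. *)
Lemma shape_content_transitive (n k : nat) (l : seq nat) (G : {group 'S_n}) :
  int_partition n l -> size l <= k ->
  shape_transitive l G -> content_transitive (fun i : 'I_k => nth 0 l i) G.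
Proof.
move=> /and3P[l_dec /allP l_pos _] lk Gtr w w' wc w'c.
pose blocks (u : {ffun 'I_n -> 'I_k}) : seq {set 'I_n} :=
  mkseq (fun i => [set x | u x == i :> nat]) (size l).
have bound (u : {ffun 'I_n -> 'I_k}) x :
    content u =1 (fun i : 'I_k => nth 0 l i) -> u x < size l.
  move=> uc; rewrite ltnNge; apply/negP => /(nth_default 0) E.
  have := uc (u x); rewrite /= E => /eqP; apply/negP; rewrite -lt0n.
  by apply/card_gt0P; exists x; rewrite inE.
have blockP u : content u =1 (fun i : 'I_k => nth 0 l i) ->
    ordered_set_partition (blocks u) /\ set_partition_shape (blocks u) = l.
  move=> uc.
  have card_block i : i < size l -> #|[set x | u x == i :> nat]| = nth 0 l i.
    by move=> il; rewrite -(uc (Ordinal (leq_trans il lk))).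
  have shapeE : set_partition_shape (blocks u) = l.
    rewrite /set_partition_shape -map_comp -[RHS](mkseq_nth 0).
    by apply/eq_in_map => i; rewrite mem_iota => /card_block.
  split=> //; apply/and4P; split; last by rewrite shapeE.
  - apply/(pairwiseP set0) => i j; rewrite !inE size_mkseq => il jl ij.
    rewrite !nth_mkseq //; apply/pred0P => x; rewrite /= !inE.
    by apply: contraTF ij => /andP[/eqP -> /eqP ->]; rewrite ltnn.
  - apply/mapP => -[i]; rewrite mem_iota => /= il /esym/eqP.
    by rewrite -cards_eq0 card_block // -leqn0 leqNgt l_pos // mem_nth.
  apply/eqP/setP => x; rewrite inE big_map.
  by rewrite (big_rem (u x : nat)) ?mem_iota ?bound //= !inE eqxx.
have [wP wl] := blockP w wc; have [w'P w'l] := blockP w' w'c.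
have [g gG gw] := Gtr _ _ wP wl w'P w'l.
exists g => // x; apply/val_inj/eqP.
have wx := bound w x wc.
have : g x \in nth set0 (blocks w') (w x).
  rewrite -gw (nth_map set0) ?size_mkseq // mem_imset; last exact: perm_inj.
  by rewrite nth_mkseq // inE.
by rewrite nth_mkseq // inE.
Qed.

(** Conversely, an ordered set partition gives the word that colours a point by
    the index of its block. *)
Lemma content_shape_transitive (n k : nat) (l : seq nat) (G : {group 'S_n}) :
  size l <= k.+1 ->
  content_transitive (fun i : 'I_k.+1 => nth 0 l i) G -> shape_transitive l G.
Proof.
move=> lk Gtr P Q Posp Pl Qosp Ql.
pose word (S : seq {set 'I_n}) : {ffun 'I_n -> 'I_k.+1} :=
  [ffun x => inord (find (fun A : {set 'I_n} => x \in A) S)].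
have size_shape (S : seq {set 'I_n}) :
    set_partition_shape S = l -> size S = size l.
  by move=> <-; rewrite size_map.
have wordP S : ordered_set_partition S -> set_partition_shape S = l ->
  (forall i x, i < size l -> (x \in nth set0 S i) = (word S x == i :> nat)) /\
  content (word S) =1 (fun i : 'I_k.+1 => nth 0 l i).
  move=> /and4P[/(pairwiseP set0) disj _ cover _] Sl.
  have sz := size_shape S Sl.
  have hasS x : has (fun A : {set 'I_n} => x \in A) S.
    have : x \in \bigcup_(A <- S) A by rewrite (eqP cover) inE.
    rewrite big_tnth => /bigcupP[i _ xi]; apply/hasP.
    by exists (tnth (in_tuple S) i); rewrite ?mem_tnth.
  have wordE x : word S x = find (fun A : {set 'I_n} => x \in A) S :> nat.
    by rewrite ffunE inordK // (leq_trans _ lk) // -sz -has_find.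
  have word_lt x : word S x < size l by rewrite wordE -sz -has_find.
  have word_mem x : x \in nth set0 S (word S x).
    by rewrite wordE; apply: (nth_find set0 (hasS x)).
  have memE i x : i < size l -> (x \in nth set0 S i) = (word S x == i :> nat).
    move=> il; apply/idP/eqP => [xi|<-//].
    have := word_lt x; rewrite -sz in il * => wl.
    case: (ltngtP (word S x) i) => // lt_wi.
      have /disjointFr := disj _ _ wl il lt_wi.
      by move/(_ _ (word_mem x)); rewrite xi.
    have /disjointFr := disj _ _ il wl lt_wi.
    by move/(_ _ xi); rewrite word_mem.
  split=> // i; rewrite /content; case: (ltnP i (size l)) => [il|li].
    rewrite -Sl /set_partition_shape (nth_map set0) ?sz //.
    by apply: eq_card => x; rewrite inE memE.
  rewrite nth_default //; apply/eq_card0 => x; rewrite inE.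
  by apply: contraTF (word_lt x) => /eqP ->; rewrite -leqNgt.
have [memP Pc] := wordP P Posp Pl; have [memQ Qc] := wordP Q Qosp Ql.
have [g gG gw] := Gtr _ _ Pc Qc; exists g => //.
have szP := size_shape P Pl; have szQ := size_shape Q Ql.
apply: (@eq_from_nth _ set0) => [|i]; rewrite size_map szP ?szQ // => il.
rewrite (nth_map set0) ?szP //; apply/setP => y.
rewrite -[y](permKV g) mem_imset; last exact: perm_inj.
by rewrite memP // memQ // gw.
Qed.

Lemma size_int_partition (n : nat) (l : seq nat) :
  int_partition n l -> size l <= n.
Proof.
case/and3P=> _ /allP l_pos /eqP <-; rewrite sumnE -sum1_size !big_seq.
exact: leq_sum.
Qed.

Lemma sum_int_partition (n k : nat) (l : seq nat) :
  int_partition n l -> n <= k -> \sum_(i < k) nth 0 l i = n.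
Proof.
move=> ln nk; have lk := leq_trans (size_int_partition ln) nk.
case/and3P: ln => _ _ /eqP <-; rewrite sumnE (big_nth 0) big_mkord.
rewrite (big_ord_widen k _ lk) [LHS](bigID (fun i : 'I_k => i < size l)) /=.
by rewrite [X in _ + X]big1 ?addn0 // => i; rewrite -leqNgt => /(nth_default 0).
Qed.

Theorem theorem3 (n : nat) (l m : seq nat) (G : {group 'S_n}) :
  2 <= n ->
  int_partition n l ->
  int_partition n m ->
  dominated l m ->
  shape_transitive l G ->
  shape_transitive m G.
Proof.
move=> _ ln mn lm Gl.
(* Partitions of n have at most n parts, so n.+1 colours serve for both l and m. *)
have ltn_size p : int_partition n p -> size p <= n.+1.
  by move/size_int_partition/leqW.
apply: (content_shape_transitive (ltn_size m mn)).
have Gc := shape_content_transitive ln (ltn_size l ln) Gl.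
have sum_l := sum_int_partition ln (leqnSn n).
have sum_m := sum_int_partition mn (leqnSn n).
apply: content_transitive_dominated Gc.
- move=> i j ij; have /and3P[l_dec _ _] := ln.
  have [jl|lj] := ltnP j (size l); last by rewrite nth_default.
  apply: (sorted_leq_nth (leT := geq)) => //.
  + by move=> x y z xy yz; apply: leq_trans yz xy.
  + exact: leqnn.
  + exact: leq_ltn_trans ij jl.
- move=> s; have [sn|ns] := leqP s n.+1.
    have := lm s; rewrite (big_ord_widen _ _ sn).
    by rewrite [X in _ <= X -> _](big_ord_widen _ _ sn).
  have all_s (i : 'I_n.+1) : (i < s) = true by rewrite (ltn_trans (ltn_ord i)).
  by rewrite !(eq_bigl _ _ all_s) sum_l sum_m.
by rewrite sum_l sum_m.
Qed.
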